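(* Let $C=[P_C,T_C,F_C,W_C,\chi,\gamma,m_{0C}]$ be a (uniform) coloured Petri net, $U$ its unfolding and $S$ its skeleton, and let $\mu$ be the net morphism from $U$ to $S$ given by $\mu([p,c])=p$ and $\mu([t,g])=t$. Extend $\mu$ to markings by $\mu(m_U)(p)=\sum_{c\in\chi(p)} m_U([p,c])$ for every $p\in P_C$, and let $\sigma$ be the function on markings (reachable or not) with $\sigma(m_U)=\mu(m_U)$. Then $\sigma$ is a surjective abstraction function from the markings of $U$ to the markings of $S$, i.e. for every marking $m_S$ of $S$ and every atomic proposition $a_S$ over the places of $S$ (with unfolding $a_U$): $m_S\models a_S$ if and only if every marking $m_U$ of $U$ with $\sigma(m_U)=m_S$ satisfies $m_U\models a_U$. Hence an abstraction relation exists between the markings of $U$ and $S$.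
   Context: A coloured Petri net $C=[P_C,T_C,F_C,W_C,\chi,\gamma,m_{0C}]$ has finite disjoint sets of places $P_C$ and transitions $T_C$, arcs $F_C\subseteq (P_C\times T_C)\cup(T_C\times P_C)$, a weight function $W_C$ assigning a finite set of variables to each arc ($W_C(x,y)=\emptyset$ if $(x,y)\notin F_C$), a colouring function $\chi$ assigning a finite set of colours $\chi(p)$ to each place, a guard $\gamma(t)$ (a Boolean predicate over the variables on arcs adjacent to $t$) for each transition, and an initial marking $m_{0C}$ assigning to each place $p$ a multiset over $\chi(p)$; $m(p)(c)$ is the number of tokens of colour $c$ on $p$. A firing mode $g$ of $t$ assigns to each variable on an arc between $t$ and a place $p$ a colour of $\chi(p)$; $g\models\gamma(t)$ means $g$ satisfies the guard. The unfolding $U$ is the place/transition net with places $[p,c]$ ($p\in P_C$, $c\in\chi(p)$), transitions $[t,g]$ ($g\models\gamma(t)$), arc weights $W_U([p,c],[t,g])=|\{x\in W_C(p,t): g(x)=c\}|$, $W_U([t,g],[p,c])=|\{x\in W_C(t,p):g(x)=c\}|$ (arc present iff weight positive), and initial marking $m_{0U}([p,c])=m_{0C}(p)(c)$. The skeleton $S$ is the place/transition net with places $P_C$, transitions $T_C$, arcs $F_C$, weights $W_S(x,y)=|W_C(x,y)|$ and initial marking $m_{0S}(p)=\sum_{c\in\chi(p)}m_{0C}(p)(c)$. An atomic proposition over a set of places is an expression $k_1p_1+\dots+k_np_n\le k$ with integers $k_i,k$; a marking $m$ of a place/transition net satisfies it iff $\sum_i k_i m(p_i)\le k$. The unfolding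 $a_U$ of an atomic proposition $a_S$ over places of $C$ (equivalently of $S$) is obtained by replacing each place $p$ by $\sum_{c\in\chi(p)}[p,c]$. An abstraction function from a set of states $Q$ to $\hat Q$ is a surjective map $\sigma:Q\to\hat Q$ such that for every $\hat q\in\hat Q$ and atomic proposition $a$: $\hat q\models a$ iff every $q$ with $\sigma(q)=\hat q$ satisfies $q\models a$.
   Formalization: Every colour set χ(p) is assumed nonempty; if some χ(p) is empty then σ(m_U)(p)=0 for all m_U, so σ is not surjective and the claim fails. *)

(* Defs.v *)
From HB Require Import structures.
From mathcomp Require Import all_boot all_order all_algebra.
From mathcomp Require Import finmap multiset.

Set Implicit Arguments.
Unset Strict Implicit.
Unset Printing Implicit Defensive.

Local Open Scope fset_scope.
Local Open Scope mset_scope.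
Local Open Scope nat_scope.

Import Order.TTheory GRing.Theory Num.Theory.

(* Candidate arcs: pairs in (P x T) u (T x P). The disjointness of places and
   transitions is built into the sum. *)
Definition net_arc (P T : Type) : Type := ((P * T) + (T * P))%type.

Record ptnet := PTNet {
  pt_place : finType;
  pt_trans : finType;
  pt_arcs : {set net_arc pt_place pt_trans};
  pt_weight : net_arc pt_place pt_trans -> nat;
  pt_weight0 : forall a, a \notin pt_arcs -> pt_weight a = 0;
  pt_init : {ffun pt_place -> nat}
}.

Definition marking (N : ptnet) : Type := {ffun pt_place N -> nat}.

Definition adjacent (P T : Type) (V : choiceType) (W : net_arc P T -> {fset V})
  (t : T) (p : P) : {fset V} := (W (inl (p, t)) `|` W (inr (t, p)))%fset.

Definition adj_vars (P T : finType) (V : choiceType) (W : net_arc P T -> {fset V})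
  (t : T) : {fset V} := \big[fsetU/fset0]_(p : P) adjacent W t p.

(* Variables and colours are drawn from arbitrary universes. A guard is a
   predicate on assignments of the variables adjacent to its transition. *)
Record cpn := CPN {
  place : finType;
  trans : finType;
  var : choiceType;
  colour : choiceType;
  arcs : {set net_arc place trans};
  weight : net_arc place trans -> {fset var};
  weight0 : forall a, a \notin arcs -> weight a = fset0;
  chi : place -> {fset colour};
  guard : forall t : trans, pred {ffun adj_vars weight t -> colour};
  init : forall p : place, {mset chi p}
}.

Section Nets.
Variable C : cpn.

Definition vars (t : trans C) : {fset var C} := adj_vars (@weight C) t.

Definition colours : {fset colour C} := \big[fsetU/fset0]_(p : place C) chi p.

(* Taking values in the finite set of all colours of the net makes the set of
   assignments finite. *)
Definition assignment (t : trans C) : finType := {ffun vars t -> colours}.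

(* A variable occurring on arcs between t and several places must be given a
   colour admissible for each of them. *)
Definition firing_mode (t : trans C) (g : assignment t) : bool :=
  [forall x : vars t, forall p : place C,
     (val x \in adjacent (@weight C) t p) ==> (val (g x) \in chi p)].

Definition satisfies_guard (t : trans C) (g : assignment t) : bool :=
  guard [ffun x => val (g x)].

Definition mode (t : trans C) : finType :=
  {g : assignment t | firing_mode g && satisfies_guard g}.

Definition unf_place : finType := {p : place C & chi p}.
Definition unf_trans : finType := {t : trans C & mode t}.

Definition upl (p : place C) (c : chi p) : unf_place := Tagged (fun p => chi p) c.

(* |{x in W_C(a) : g(x) = c}|, for an arc a adjacent to t. *)
Definition colour_count (a : net_arc (place C) (trans C)) (t : trans C)
  (g : mode t) (c : colour C) : nat :=
  #|[set x : vars t | (val x \in weight a) && (val (val g x) == c)]|.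

Definition unf_weight (a : net_arc unf_place unf_trans) : nat :=
  match a with
  | inl (pc, tg) =>
      colour_count (inl (tag pc, tag tg)) (tagged tg) (val (tagged pc))
  | inr (tg, pc) =>
      colour_count (inr (tag tg, tag pc)) (tagged tg) (val (tagged pc))
  end.

Definition unf_arcs : {set net_arc unf_place unf_trans} :=
  [set a | 0 < unf_weight a].

Lemma unf_weight0 a : a \notin unf_arcs -> unf_weight a = 0.
Proof. by rewrite inE -eqn0Ngt => /eqP. Qed.

Definition unfolding : ptnet :=
  PTNet unf_weight0 [ffun pc : unf_place => init (tag pc) (tagged pc)].

Definition skel_weight (a : net_arc (place C) (trans C)) : nat := #|` weight a|.

Lemma skel_weight0 a : a \notin arcs C -> skel_weight a = 0.
Proof. by move=> aF; rewrite /skel_weight weight0 ?cardfs0. Qed.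

Definition skeleton : ptnet :=
  PTNet skel_weight0 [ffun p : place C => \sum_(c : chi p) init p c].

Definition mu_place (pc : pt_place unfolding) : pt_place skeleton := tag pc.
Definition mu_trans (tg : pt_trans unfolding) : pt_trans skeleton := tag tg.

Definition mu_arc (a : net_arc (pt_place unfolding) (pt_trans unfolding)) :
  net_arc (pt_place skeleton) (pt_trans skeleton) :=
  match a with
  | inl (pc, tg) => inl (mu_place pc, mu_trans tg)
  | inr (tg, pc) => inr (mu_trans tg, mu_place pc)
  end.

Lemma mu_arc_morphism a : a \in pt_arcs unfolding -> mu_arc a \in pt_arcs skeleton.
Proof.
rewrite inE /=; apply: contraLR => aF; rewrite -eqn0Ngt; apply/eqP.
by case: a aF => [[pc tg]|[tg pc]] /= aF;
  apply: eq_card0 => x; rewrite inE (weight0 aF) in_fset0.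
Qed.

Definition mu_marking (m : marking unfolding) : marking skeleton :=
  [ffun p : place C => \sum_(c : chi p) m (upl c)].

Lemma mu_init : mu_marking (pt_init unfolding) = pt_init skeleton.
Proof. by apply/ffunP=> p; rewrite !ffunE; apply: eq_bigr => c _; rewrite ffunE. Qed.

End Nets.

Lemma colour_count_sum (C : cpn) (a : net_arc (place C) (trans C)) (p : place C)
  (t : trans C) (g : mode t) :
  (weight a `<=` adjacent (@weight C) t p)%fset ->
  \sum_(c : chi p) colour_count a g (val c) = #|` weight a|.
Proof.
move=> aw; have sub x : x \in weight a -> x \in vars t.
  move=> xa; rewrite /vars /adj_vars (bigD1 p) //=.
  by rewrite in_fsetU (fsubsetP aw).
have -> : #|` weight a| = #|[set x : vars t | val x \in weight a]|.
  rewrite [RHS]cardE -(size_map val) -[LHS]/(size (weight a)).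
  apply: perm_size; apply: uniq_perm; rewrite ?fset_uniq ?(map_inj_uniq val_inj) ?enum_uniq //.
  move=> x; apply/idP/mapP=> [xa|[y]].
    by exists (FSetSub (sub x xa)) => //; rewrite mem_enum inE.
  by rewrite mem_enum inE => ya ->.
rewrite -sum1_card [RHS](eq_bigr (fun x : vars t => \sum_(c : chi p | val c == val (val g x)) 1)).
  rewrite (exchange_big_dep predT) //=; apply: eq_bigr => c _.
  rewrite /colour_count -sum1_card; apply: eq_bigl => x.
  by rewrite !inE [_ == fsval c]eq_sym.
move=> x; rewrite inE => xa.
have /andP[/forallP/(_ x)/forallP/(_ p)/implyP/(_ (fsubsetP aw _ xa)) gx _] := valP g.
by rewrite (big_pred1 (FSetSub gx)).
Qed.

(* Every mode of a transition moves W_S-many tokens along each arc: such a net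
   is always uniform. *)
Lemma mu_weight_pt (C : cpn) (p : place C) (tg : pt_trans (unfolding C)) :
  \sum_(c : chi p) @pt_weight (unfolding C) (inl (upl c, tg)) =
  @pt_weight (skeleton C) (inl (p, mu_trans tg)).
Proof. exact: colour_count_sum (tagged tg) (fsubsetUl _ _). Qed.

Lemma mu_weight_tp (C : cpn) (p : place C) (tg : pt_trans (unfolding C)) :
  \sum_(c : chi p) @pt_weight (unfolding C) (inr (tg, upl c)) =
  @pt_weight (skeleton C) (inr (mu_trans tg, p)).
Proof. exact: colour_count_sum (tagged tg) (fsubsetUr _ _). Qed.

(* The formal expression k_1 p_1 + ... + k_n p_n <= k. *)
Record atomic (P : Type) := Atomic { terms : seq (int * P); bound : int }.

Definition satisfies (N : ptnet) (m : marking N) (a : atomic (pt_place N)) : Prop :=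
  (\sum_(kp <- terms a) kp.1 * (m kp.2)%:Z <= bound a)%R.

Definition unfold_atomic (C : cpn) (a : atomic (pt_place (skeleton C))) :
  atomic (pt_place (unfolding C)) :=
  Atomic [seq (kp.1, upl c) | kp <- terms a, c <- enum {: chi kp.2}] (bound a).

(* Q and Qh interpret the same atomic propositions AP, each by its own
   satisfaction relation. *)
Definition abstraction_function (Q Qh AP : Type) (sat : Q -> AP -> Prop)
  (sath : Qh -> AP -> Prop) (sigma : Q -> Qh) : Prop :=
  (forall qh, exists q, sigma q = qh) /\
  (forall qh a, sath qh a <-> (forall q, sigma q = qh -> sat q a)).

Definition abstraction_relation (Q Qh AP : Type) (sat : Q -> AP -> Prop)
  (sath : Qh -> AP -> Prop) (R : Q -> Qh -> Prop) : Prop :=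
  exists2 sigma : Q -> Qh, abstraction_function sat sath sigma &
    forall q qh, R q qh <-> sigma q = qh.

Definition sat_U (C : cpn) (m : marking (unfolding C))
  (a : atomic (pt_place (skeleton C))) : Prop := satisfies m (unfold_atomic a).

Definition sat_S (C : cpn) (m : marking (skeleton C))
  (a : atomic (pt_place (skeleton C))) : Prop := satisfies m a.

Definition sigma (C : cpn) : marking (unfolding C) -> marking (skeleton C) :=
  @mu_marking C.

(* Main.v *)
Require Import Defs.
From mathcomp Require Import all_boot all_order all_algebra.
From mathcomp Require Import finmap multiset.

(* The unfolded proposition a_U sums, over all colours, exactly the tokens that
   sigma adds up, so m_U |= a_U iff sigma(m_U) |= a_S. Since sigma is surjective
   (put all tokens of a place on a single colour), no fibre is empty and the
   equivalence with "all m_U in the fibre satisfy a_U" follows. *)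

Lemma sat_U_sigma (C : cpn) (m : marking (unfolding C))
  (a : atomic (pt_place (skeleton C))) : sat_U m a <-> sat_S (sigma m) a.
Proof.
rewrite /sat_U /sat_S /satisfies /unfold_atomic /= big_allpairs_dep /=.
under eq_bigr => kp _ do rewrite -GRing.mulr_sumr big_enum /=.
(* The cast to [int] is pushed inside the sum over colours; [natz] is used in both directions
   because [natr_sum] speaks of [%:R]. *)
under [X in _ <-> is_true (X <= _)%R]eq_bigr => kp _
  do rewrite /sigma /mu_marking ffunE -[Posz _]natz GRing.natr_sum.
under [X in _ <-> is_true (X <= _)%R]eq_bigr => kp _
  do under eq_bigr => c _ do rewrite natz.
by [].
Qed.

(** [pick] selects one colour per place without a proof that [chi p] is inhabited. *)
Definition concentrated_marking (C : cpn) (m : marking (skeleton C)) :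
  marking (unfolding C) :=
  [ffun pc : unf_place C =>
     if [pick c : chi (tag pc)] == Some (tagged pc) then m (tag pc) else 0%N].

(** On a place without colours the sum in [sigma] is empty, so only the count 0 could be reached
    there; [chi_neq0] excludes this. *)
Lemma sigma_concentrated_marking (C : cpn) (m : marking (skeleton C)) :
  (forall p : place C, chi p <> fset0) ->
  sigma (concentrated_marking C m) = m.
Proof.
move=> chi_neq0; apply/ffunP => p; rewrite ffunE.
under eq_bigr => c _ do rewrite ffunE /=.
rewrite -big_mkcond /=; case: pickP => [c0 _|no_colour].
  by rewrite (big_pred1 c0) // => c; rewrite eq_sym.
have /eqP/fset0Pn[c cp] := chi_neq0 p.
by have := no_colour (FSetSub cp).
Qed.

Theorem theorem1 (C : cpn) (chi_neq0 : forall p : place C, chi p <> fset0) :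
  abstraction_function (@sat_U C) (@sat_S C) (@sigma C) /\
  exists R : marking (unfolding C) -> marking (skeleton C) -> Prop,
    abstraction_relation (@sat_U C) (@sat_S C) R.
Proof.
have sigma_abs : abstraction_function (@sat_U C) (@sat_S C) (@sigma C).
  split=> [mS|mS a].
    by exists (concentrated_marking C mS); apply: sigma_concentrated_marking.
  split=> [sat_mS mU mUS|sat_fibre].
    by apply/sat_U_sigma; rewrite mUS.
  have mUS := sigma_concentrated_marking C mS chi_neq0.
  by rewrite -mUS; apply/sat_U_sigma/sat_fibre.
by split=> //; exists (fun mU mS => sigma mU = mS), (@sigma C).
Qed.
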